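(* Let $(w,\theta)$ be a pair of class $(BT)$ on an open simply connected set $U\subset\mathbb{C}$ containing the origin. Let $R_0=R(0,0)\in\mathbb{R}$ and $S_0=S(0,0)\in\mathbb{R}\setminus\{0\}$. Let $\Omega$ be the set of all $(x,y)$ such that the segment from $(0,0)$ to $(x,0)$ and the segment from $(x,0)$ to $(x,y)$ lie in $U$ (the largest open simply connected set containing the origin on which the following expressions make sense). On $\Omega$ set \begin{align*} I_1(x)&=\int_0^x\cosh w(t,0)\,\sin\theta(t,0)\,dt,\\ I_2(x,y)&=\int_0^y\sinh w(x,s)\,\cos\theta(x,s)\,ds,\\ I_3(x)&=\int_0^x e^{2I_1(t)}\cosh w(t,0)\,\cos\theta(t,0)\,dt,\\ I_4(x,y)&=e^{2I_1(x)}\int_0^y e^{2I_2(x,s)}\sinh w(x,s)\,\sin\theta(x,s)\,ds, \end{align*} and define $$S(x,y)=S_0\,e^{2(I_1(x)+I_2(x,y))},\qquad R(x,y)=R_0+2S_0\,\bigl(I_3(x)-I_4(x,y)\bigr).$$ Then $u=R+iS$ is, on $\Omega$, the harmonic map to the hyperbolic plane that corresponds to $w$.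
   Context: Points of $\mathbb{C}$ are written $z=x+iy$ and identified with $(x,y)$; $\partial_z=\frac12(\partial_x-i\partial_y)$, $\partial_{\bar z}=\frac12(\partial_x+i\partial_y)$, $\Delta=\partial_{xx}^2+\partial_{yy}^2$. Class $(BT)$: a pair of real-valued $C^2$ functions $(w,\theta)$ on an open set is in the class $(BT)$ if it satisfies the Bäcklund transformation $$\partial_x w-\partial_y\theta=-2\sinh w\,\sin\theta,\qquad \partial_y w+\partial_x\theta=-2\cosh w\,\cos\theta .$$ Consequently $w$ solves the sinh-Gordon equation $\Delta w=2\sinh(2w)$ and $\theta$ solves the sine-Gordon equation $\Delta\theta=-2\sin(2\theta)$. Target: the hyperbolic plane is the half-plane with coordinates $R+iS$ and metric $(dR^2+dS^2)/S^2$ of curvature $-1$ (the upper half-plane when $S>0$; for $S<0$ the lower half-plane with the same formula for the metric). Harmonic map corresponding to $w$: for a solution $w$ of $\Delta w=2\sinh(2w)$ on an open simply connected set $\Omega\ni 0$, a $C^2$ map $u=R+iS$ on $\Omega$ with $S$ nowhere zero is called the harmonic map (to the hyperbolic plane) that corresponds to $w$ if it satisfies the Beltrami equation $\partial_{\bar z}u/\partial_z u=e^{-2w}$ and it is harmonic for the metric $(dR^2+dS^2)/S^2$, i.e. $\partial^2_{z\bar z}u+\frac{i}{S}\,\partial_z u\,\partial_{\bar z}u=0$, with the domain coordinate normalized so that $\dfrac{\partial_z u\,\partial_z\bar u}{S^2}=1$. (Uniqueness is not part of the assertion.) *)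

(* Defs.v *)
(* Stdlib reals with Coquelicot. *)
From Stdlib Require Import Reals.
From Coquelicot Require Import Coquelicot.
Open Scope R_scope.

(* Sets are subsets of Coquelicot's C = R * R, so z = x + iy is literally the
   pair (x, y).  Functions are curried, f x y, and total: values outside the
   set under consideration are irrelevant. *)

Definition path_in (D : C -> Prop) (g : R -> C) : Prop :=
  continuous_on (fun t : R => 0 <= t <= 1) g /\
  (forall t : R, 0 <= t <= 1 -> D (g t)).

Definition path_connected (D : C -> Prop) : Prop :=
  forall a b : C, D a -> D b ->
  exists g : R -> C, path_in D g /\ g 0 = a /\ g 1 = b.

(* H s is the loop at time s of a homotopy of closed curves in D. *)
Definition null_homotopic (D : C -> Prop) (g : R -> C) : Prop :=
  exists (H : R * R -> C) (c : C),
    continuous_on (fun p : R * R => 0 <= fst p <= 1 /\ 0 <= snd p <= 1) H /\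
    (forall s t : R, 0 <= s <= 1 -> 0 <= t <= 1 -> D (H (s, t))) /\
    (forall t : R, 0 <= t <= 1 -> H (0, t) = g t) /\
    (forall t : R, 0 <= t <= 1 -> H (1, t) = c) /\
    (forall s : R, 0 <= s <= 1 -> H (s, 0) = H (s, 1)).

Definition simply_connected (D : C -> Prop) : Prop :=
  path_connected D /\
  (forall g : R -> C, path_in D g -> g 0 = g 1 -> null_homotopic D g).

Definition segment (a b z : C) : Prop :=
  exists t : R, 0 <= t <= 1 /\ z = (a + RtoC t * (b - a))%C.

(* Coquelicot's [ex_diff_n f n x y]: at (x, y) all partial derivatives of f
   of order <= n exist and are continuous. *)
Definition C2_on (D : C -> Prop) (f : R -> R -> R) : Prop :=
  forall x y : R, D (x, y) -> ex_diff_n f 2 x y.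

Definition dx (f : R -> R -> R) (x y : R) : R := Derive (fun t : R => f t y) x.
Definition dy (f : R -> R -> R) (x y : R) : R := Derive (fun t : R => f x t) y.

Definition laplacian (f : R -> R -> R) (x y : R) : R :=
  dx (dx f) x y + dy (dy f) x y.

Definition Re_part (u : R -> R -> C) (x y : R) : R := Re (u x y).
Definition Im_part (u : R -> R -> C) (x y : R) : R := Im (u x y).

Definition Cdx (u : R -> R -> C) (x y : R) : C :=
  (dx (Re_part u) x y, dx (Im_part u) x y).
Definition Cdy (u : R -> R -> C) (x y : R) : C :=
  (dy (Re_part u) x y, dy (Im_part u) x y).

Definition d_z (u : R -> R -> C) (x y : R) : C :=
  (RtoC (1 / 2) * (Cdx u x y - Ci * Cdy u x y))%C.
Definition d_zbar (u : R -> R -> C) (x y : R) : C :=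
  (RtoC (1 / 2) * (Cdx u x y + Ci * Cdy u x y))%C.

Definition class_BT (D : C -> Prop) (w theta : R -> R -> R) : Prop :=
  C2_on D w /\ C2_on D theta /\
  (forall x y : R, D (x, y) ->
     dx w x y - dy theta x y = - 2 * sinh (w x y) * sin (theta x y) /\
     dy w x y + dx theta x y = - 2 * cosh (w x y) * cos (theta x y)).

Definition sinh_gordon (D : C -> Prop) (w : R -> R -> R) : Prop :=
  C2_on D w /\
  (forall x y : R, D (x, y) -> laplacian w x y = 2 * sinh (2 * w x y)).

(* Since Coquelicot's division is total, [d_z u x y <> 0] makes the quotient
   in the Beltrami equation meaningful. *)
Definition beltrami (D : C -> Prop) (w : R -> R -> R) (u : R -> R -> C) : Prop :=
  forall x y : R, D (x, y) ->
    d_z u x y <> RtoC 0 /\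
    (d_zbar u x y / d_z u x y)%C = RtoC (exp (- 2 * w x y)).

(* Harmonicity for the target metric (dR^2 + dS^2) / S^2. *)
Definition harmonic (D : C -> Prop) (u : R -> R -> C) : Prop :=
  forall x y : R, D (x, y) ->
    (d_z (d_zbar u) x y
     + Ci / RtoC (Im (u x y)) * (d_z u x y * d_zbar u x y))%C = RtoC 0.

Definition hopf_normalized (D : C -> Prop) (u : R -> R -> C) : Prop :=
  forall x y : R, D (x, y) ->
    (d_z u x y * d_z (fun a b : R => Cconj (u a b)) x y
     / RtoC (Im (u x y) ^ 2))%C = RtoC 1.

Definition corresponding_harmonic_map
    (D : C -> Prop) (w : R -> R -> R) (u : R -> R -> C) : Prop :=
  (open D /\ simply_connected D /\ D (0, 0)) /\
  sinh_gordon D w /\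
  (C2_on D (Re_part u) /\ C2_on D (Im_part u)) /\
  (forall x y : R, D (x, y) -> Im (u x y) <> 0) /\
  beltrami D w u /\ harmonic D u /\ hopf_normalized D u.

Definition Omega (U : C -> Prop) (z : C) : Prop :=
  (forall p : C, segment (0, 0) (Re z, 0) p -> U p) /\
  (forall p : C, segment (Re z, 0) (Re z, Im z) p -> U p).

Definition I1 (w theta : R -> R -> R) (x : R) : R :=
  RInt (fun t : R => cosh (w t 0) * sin (theta t 0)) 0 x.

Definition I2 (w theta : R -> R -> R) (x y : R) : R :=
  RInt (fun s : R => sinh (w x s) * cos (theta x s)) 0 y.

Definition I3 (w theta : R -> R -> R) (x : R) : R :=
  RInt (fun t : R =>
          exp (2 * I1 w theta t) * cosh (w t 0) * cos (theta t 0)) 0 x.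

Definition I4 (w theta : R -> R -> R) (x y : R) : R :=
  exp (2 * I1 w theta x) *
  RInt (fun s : R =>
          exp (2 * I2 w theta x s) * sinh (w x s) * sin (theta x s)) 0 y.

Definition S_map (w theta : R -> R -> R) (S0 x y : R) : R :=
  S0 * exp (2 * (I1 w theta x + I2 w theta x y)).

Definition R_map (w theta : R -> R -> R) (R0 S0 x y : R) : R :=
  R0 + 2 * S0 * (I3 w theta x - I4 w theta x y).

Definition u_map (w theta : R -> R -> R) (R0 S0 x y : R) : C :=
  (RtoC (R_map w theta R0 S0 x y) + Ci * RtoC (S_map w theta S0 x y))%C.

(* Main.v *)
Require Import Defs.
From Stdlib Require Import Reals Lra Classical.
From Coquelicot Require Import Coquelicot.
Open Scope R_scope.

(** The formulas for S and R integrate closed 1-forms.  Write ch, sh for the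
    hyperbolic functions of w and c, s for cos theta, sin theta.  The form
    (ch s) dx + (sh c) dy is closed: the difference of its mixed derivatives is
    ch c times the left side of the first Backlund equation minus sh s times
    that of the second, and the right sides make this vanish.  Integrating a
    closed form along the horizontal and then the vertical leg of an L gives a
    primitive on [Omega U] ([potential_partials]: differentiation under the
    integral sign and the fundamental theorem of calculus), and I1 + I2 is that
    primitive.  Hence dS = 2 S (ch s dx + sh c dy).

    With this S the form 2 S (ch c dx - sh s dy) is closed in turn, and R - R0
    is its primitive along the same L-shaped paths.  That form lives only on
    [Omega U], but [Omega] is idempotent, so the same lemma applies with
    [Omega U] in place of [U].

    From the four first-order derivatives, u = R + i S satisfies
      d_z u = S exp (w + i theta),   d_zbar u = S exp (- w + i theta).
    Everything else is read off from these two formulas: the quotient is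
    exp (-2 w), the product of d_z u with the conjugate of d_zbar u is S^2, and
    differentiating d_zbar u once more and substituting the Backlund equations
    gives -i S exp (2 i theta), which cancels (i / S) d_z u d_zbar u.  The
    sinh-Gordon equation comes from differentiating the Backlund equations and
    the symmetry of the second derivatives of theta.

    [Omega U] is open because a compact segment in an open set has a uniform
    neighbourhood ([segment_tube]), and it is contractible: a point is pushed
    first down its vertical leg, then along the horizontal one ([retract]). *)

(** * L-shaped paths and the set they reach *)

(** The interval with end points 0 and [a] in either order, in the form in
    which the integration lemmas ask for it. *)
Definition between (a s : R) : Prop := Rmin 0 a <= s <= Rmax 0 a.

Lemma between_scale r a : 0 <= r <= 1 -> between a (r * a).
Proof.
intros Hr; unfold between, Rmin, Rmax; destruct (Rle_dec 0 a); split; nra.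
Qed.

Lemma between_param a s : between a s -> exists r, 0 <= r <= 1 /\ s = r * a.
Proof.
intros Hs; destruct (Req_dec a 0) as [-> | Ha].
- exists 0; unfold between, Rmin, Rmax in Hs.
  destruct (Rle_dec 0 0); split; lra.
- exists (s / a); split; [| field; exact Ha].
  assert (Hk : s / a * a = s) by (field; exact Ha).
  unfold between, Rmin, Rmax in Hs; destruct (Rle_dec 0 a); split; nra.
Qed.

Lemma between_trans a b s : between a b -> between b s -> between a s.
Proof.
unfold between, Rmin, Rmax.
destruct (Rle_dec 0 a); destruct (Rle_dec 0 b); lra.
Qed.

Lemma between_0 a : between a 0.
Proof. unfold between, Rmin, Rmax; destruct (Rle_dec 0 a); lra. Qed.

Lemma between_refl a : between a a.
Proof. unfold between, Rmin, Rmax; destruct (Rle_dec 0 a); lra. Qed.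

(** The legs of L-shaped paths to nearby points are close, even when the
    leg changes its orientation. *)
Lemma between_near a b d s :
  Rabs (b - a) < d -> between b s ->
  exists t, between a t /\ Rabs (s - t) < d.
Proof.
intros Hd Hs; apply Rabs_def2 in Hd.
assert (Ht : between a s \/ s < Rmin 0 a \/ Rmax 0 a < s)
  by (unfold between; lra).
destruct Ht as [Ht | [Ht | Ht]];
  [exists s | exists (Rmin 0 a) | exists (Rmax 0 a)];
  revert Hs Ht; unfold between, Rmin, Rmax;
  destruct (Rle_dec 0 a); destruct (Rle_dec 0 b);
  intros Hs Ht; (split; [lra | apply Rabs_def1; lra]).
Qed.

Lemma Omega_between (U : C -> Prop) (x y : R) :
  Omega U (x, y) <->
  (forall s, between x s -> U (s, 0)) /\ (forall s, between y s -> U (x, s)).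
Proof.
unfold Omega; simpl; split; intros [H1 H2]; split.
- intros s Hs; apply H1; destruct (between_param x s Hs) as [r [Hr ->]].
  exists r; split; [exact Hr |]; apply injective_projections; simpl; ring.
- intros s Hs; apply H2; destruct (between_param y s Hs) as [r [Hr ->]].
  exists r; split; [exact Hr |]; apply injective_projections; simpl; ring.
- intros p [r [Hr ->]].
  replace (_ + _)%C with ((r * x, 0) : C)
    by (apply injective_projections; simpl; ring).
  apply H1, between_scale, Hr.
- intros p [r [Hr ->]].
  replace (_ + _)%C with ((x, r * y) : C)
    by (apply injective_projections; simpl; ring).
  apply H2, between_scale, Hr.
Qed.

Lemma Omega_sub (U : C -> Prop) (x y : R) : Omega U (x, y) -> U (x, y).
Proof. intros H; apply Omega_between in H; apply H, between_refl. Qed.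

(** L-shaped paths to points of an L-shaped path stay on it: a point of the
    vertical leg ([x' = x]) or of the horizontal leg ([y' = 0]) is reached
    inside the path to [(x, y)]. *)
Lemma Omega_hull (U : C -> Prop) (x y x' y' : R) :
  Omega U (x, y) -> between x x' -> between y y' ->
  (x' = x \/ y' = 0) -> Omega U (x', y').
Proof.
intros H Hx Hy Hc; apply Omega_between in H; destruct H as [H1 H2].
apply Omega_between; split.
- intros s Hs; apply H1; exact (between_trans x x' s Hx Hs).
- intros s Hs; destruct Hc as [-> | ->].
  + apply H2; exact (between_trans y y' s Hy Hs).
  + replace s with 0; [exact (H1 x' Hx) |].
    unfold between, Rmin, Rmax in Hs; destruct (Rle_dec 0 0); lra.
Qed.

(** This lets a form defined only on [Omega U] be integrated along the same
    paths as one defined on [U]. *)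
Lemma Omega_idem (U : C -> Prop) (x y : R) :
  Omega U (x, y) -> Omega (Omega U) (x, y).
Proof.
intros H; apply Omega_between; split; intros s Hs.
- apply (Omega_hull U x y); auto using between_0.
- apply (Omega_hull U x y); auto using between_refl.
Qed.

Lemma open_locally_2d (D : C -> Prop) (x y : R) :
  open D -> D (x, y) -> locally_2d (fun u v => D (u, v)) x y.
Proof.
intros HD H; apply locally_2d_locally.
generalize (HD (x, y) H); apply filter_imp; intros [u v]; exact (fun h => h).
Qed.

(** Compactness of the segment: the radii of the neighbourhoods given at its
    points can be chosen bounded below. *)
Lemma segment_tube (P : R -> R -> Prop) (x a b : R) :
  (forall t, a <= t <= b -> locally_2d P x t) ->
  exists d : posreal, forall u v t,
    a <= t <= b -> Rabs (u - x) < d -> Rabs (v - t) < d -> P u v.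
Proof.
intros H.
assert (Hdelta : forall t, {d : posreal | a <= t <= b ->
   forall u v, Rabs (u - x) < d -> Rabs (v - t) < d -> P u v}).
{ intros t; destruct (Rle_dec a t) as [h1 | n];
    [destruct (Rle_dec t b) as [h2 | n] |].
  - destruct (locally_2d_ex_dec P x t (fun u v => classic (P u v)) (H t (conj h1 h2)))
      as [d Hd].
    exists d; auto.
  - exists (mkposreal 1 Rlt_0_1); lra.
  - exists (mkposreal 1 Rlt_0_1); lra. }
(* Radii are halved so that a point close to [t], itself close to a centre
   [t0], is still within the radius of [t0]. *)
destruct (compactness_value_1d a b
            (fun t => pos_div_2 (proj1_sig (Hdelta t)))) as [d Hd].
exists d; intros u v t Ht Hu Hv.
destruct (NNPP _ (Hd t Ht)) as [t0 [Ht0 [Htt Hdt]]].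
destruct (Hdelta t0) as [e He]; simpl in Htt, Hdt.
apply (He Ht0).
- apply Rlt_le_trans with (1 := Hu); pose proof (cond_pos e); lra.
- replace (v - t0) with ((v - t) + (t - t0)) by ring.
  apply Rle_lt_trans with (1 := Rabs_triang _ _); lra.
Qed.

Lemma Omega_open (U : C -> Prop) : open U -> open (Omega U).
Proof.
intros HU [x y] H; apply Omega_between in H; destruct H as [H1 H2].
destruct (segment_tube (fun u v => U (v, u)) 0 (Rmin 0 x) (Rmax 0 x)) as [d1 Hd1].
{ intros t Ht; destruct (open_locally_2d U t 0 HU (H1 t Ht)) as [d Hd].
  exists d; auto. }
destruct (segment_tube (fun u v => U (u, v)) x (Rmin 0 y) (Rmax 0 y)) as [d2 Hd2].
{ intros t Ht; exact (open_locally_2d U x t HU (H2 t Ht)). }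
assert (Hd : 0 < Rmin d1 d2) by (apply Rmin_pos; apply cond_pos).
exists (mkposreal _ Hd); intros [x' y'] [Bx By].
change (Rabs (x' - x) < Rmin d1 d2) in Bx.
change (Rabs (y' - y) < Rmin d1 d2) in By.
pose proof (Rmin_l d1 d2); pose proof (Rmin_r d1 d2).
apply Omega_between; split; intros s Hs.
- destruct (between_near x x' d1 s) as [t [Ht Hst]]; [lra | exact Hs |].
  apply (Hd1 0 s t Ht); [| exact Hst].
  rewrite Rminus_diag, Rabs_R0; apply cond_pos.
- destruct (between_near y y' d2 s) as [t [Ht Hst]]; [lra | exact Hs |].
  apply (Hd2 x' s t Ht); [lra | exact Hst].
Qed.

(** * Contracting the set to the origin *)

Definition clip (u : R) : R := Rmax 0 (Rmin 1 u).

Lemma clip_range u : 0 <= clip u <= 1.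
Proof.
split; [apply Rmax_l | apply Rmax_lub; [lra | apply Rmin_l]].
Qed.

Lemma clip_ge1 u : 1 <= u -> clip u = 1.
Proof. intros H; unfold clip; rewrite Rmin_left, Rmax_right; lra. Qed.

Lemma clip_le0 u : u <= 0 -> clip u = 0.
Proof. intros H; unfold clip; rewrite Rmin_right, Rmax_left; lra. Qed.

Lemma clip_continuous u : continuous clip u.
Proof.
apply filterlim_locally; intros eps; exists eps; intros v Hv.
change (Rabs (v - u) < eps) in Hv; change (Rabs (clip v - clip u) < eps).
apply Rle_lt_trans with (2 := Hv); unfold clip.
unfold Rmin; destruct (Rle_dec 1 v); destruct (Rle_dec 1 u);
  unfold Rmax; repeat destruct Rle_dec;
  unfold Rabs; repeat destruct Rcase_abs; lra.
Qed.

(** For [s] in [0, 1/2] the vertical coordinate shrinks to 0 while the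
    horizontal one is kept; for [s] in [1/2, 1] the horizontal one follows. *)
Definition retract (s : R) (z : C) : C :=
  (clip (2 - 2 * s) * fst z, clip (1 - 2 * s) * snd z).

Lemma retract_start s z : s <= 0 -> retract s z = z.
Proof.
intros Hs; unfold retract; rewrite !clip_ge1 by lra.
apply injective_projections; simpl; ring.
Qed.

Lemma retract_end s z : 1 <= s -> retract s z = (0, 0).
Proof.
intros Hs; unfold retract; rewrite !clip_le0 by lra.
apply injective_projections; simpl; ring.
Qed.

Lemma retract_Omega (U : C -> Prop) s z : Omega U z -> Omega U (retract s z).
Proof.
destruct z as [x y]; intros H.
apply (Omega_hull U x y); simpl; auto using between_scale, clip_range.
destruct (Rle_dec s (1 / 2)).
- left; rewrite clip_ge1 by lra; ring.
- right; rewrite clip_le0 by lra; ring.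
Qed.

Lemma filterlim_C {T : Type} (F : (T -> Prop) -> Prop) {FF : Filter F}
    (f : T -> C) (z : C) :
  filterlim (fun q => fst (f q)) F (locally (fst z)) ->
  filterlim (fun q => snd (f q)) F (locally (snd z)) ->
  filterlim f F (locally z).
Proof.
intros H1 H2; apply filterlim_locally; intros eps.
generalize (filter_and _ _ (proj1 (filterlim_locally _ _) H1 eps)
                           (proj1 (filterlim_locally _ _) H2 eps)).
apply filter_imp; intros q [h1 h2]; split; assumption.
Qed.

Lemma filterlim_Rmult_fun {T : Type} (F : (T -> Prop) -> Prop) {FF : Filter F}
    (f g : T -> R) (a b : R) :
  filterlim f F (locally a) -> filterlim g F (locally b) ->
  filterlim (fun q => f q * g q) F (locally (a * b)).
Proof.
intros Hf Hg; exact (filterlim_comp_2 _ _ _ Hf Hg (filterlim_mult a b)).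
Qed.

Lemma filterlim_retract {T : Type} (F : (T -> Prop) -> Prop) {FF : Filter F}
    (sigma : T -> R) (zeta : T -> C) (s : R) (z : C) :
  filterlim sigma F (locally s) -> filterlim zeta F (locally z) ->
  filterlim (fun q => retract (sigma q) (zeta q)) F (locally (retract s z)).
Proof.
intros Hs Hz.
assert (Hc : forall c, filterlim (fun q => clip (c - 2 * sigma q)) F
                         (locally (clip (c - 2 * s)))).
{ intros c; apply (filterlim_comp _ _ _ sigma (fun u => clip (c - 2 * u))
                     F (locally s)); [exact Hs |].
  apply (continuous_comp (fun u => c - 2 * u) clip); [| apply clip_continuous].
  apply (ex_derive_continuous (fun u => c - 2 * u)); auto_derive; exact I. }
apply (filterlim_C F); simpl; apply (filterlim_Rmult_fun F); try apply Hc.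
- apply (filterlim_comp _ _ _ zeta fst F (locally z)); [exact Hz |].
  destruct z as [x y]; apply (continuous_fst x y).
- apply (filterlim_comp _ _ _ zeta snd F (locally z)); [exact Hz |].
  destruct z as [x y]; apply (continuous_snd x y).
Qed.

(** The contraction to the origin is a free homotopy of any loop to a constant
    loop. *)
Lemma Omega_simply_connected (U : C -> Prop) : simply_connected (Omega U).
Proof.
split.
- intros a b Ha Hb.
  (* For every [t] one of the two summands is 0: the path runs from [a] to the
     origin in the first half and from the origin to [b] in the second. *)
  exists (fun t => (retract (2 * t) a + retract (2 - 2 * t) b)%C).
  split; [split |].
  + intros t _; apply (filterlim_filter_le_1 (G := within _ (locally t))
      (F := locally t)); [apply filter_le_within; typeclasses eauto |].
    assert (Hr : forall (sigma : R -> R) (z : C), ex_derive sigma t ->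
        filterlim (fun r => retract (sigma r) z) (locally t)
          (locally (retract (sigma t) z))).
    { intros sigma z Hsigma.
      apply (filterlim_retract (locally t)); [| apply filterlim_const].
      exact (ex_derive_continuous sigma t Hsigma). }
    assert (Ha' := Hr (fun r => 2 * r) a ltac:(auto_derive; exact I)).
    assert (Hb' := Hr (fun r => 2 - 2 * r) b ltac:(auto_derive; exact I)).
    exact (filterlim_comp_2 _ _ _ Ha' Hb'
      (filterlim_plus (V := C_R_NormedModule)
         (retract (2 * t) a) (retract (2 - 2 * t) b))).
  + intros t _; destruct (Rle_dec t (1 / 2)).
    * rewrite (retract_end (2 - 2 * t)) by lra.
      change ((0, 0) : C) with (RtoC 0); rewrite Cplus_0_r.
      apply retract_Omega, Ha.
    * rewrite (retract_end (2 * t)) by lra.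
      change ((0, 0) : C) with (RtoC 0); rewrite Cplus_0_l.
      apply retract_Omega, Hb.
  + rewrite (retract_start (2 * 0)), (retract_end (2 - 2 * 0)),
      (retract_end (2 * 1)), (retract_start (2 - 2 * 1)) by lra.
    change ((0, 0) : C) with (RtoC 0); rewrite Cplus_0_r, Cplus_0_l.
    split; reflexivity.
- intros g [Hg HU] Hloop.
  exists (fun p => retract (fst p) (g (snd p))), (0, 0).
  split; [| split; [| split; [| split]]].
  + intros [s t] [Hs Ht]; simpl in Hs, Ht.
    apply (filterlim_retract _ fst (fun p => g (snd p)) s (g t)).
    * apply (filterlim_filter_le_1 (G := within _ (locally (s, t)))
        (F := locally (s, t))); [apply filter_le_within; typeclasses eauto |].
      apply (continuous_fst s t).
    * apply (filterlim_comp _ _ _ snd g _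
               (within (fun t => 0 <= t <= 1) (locally t))); [| apply Hg, Ht].
      intros P [d Hd]; exists d; intros [s' t'] [_ Bt] [_ Ht'].
      exact (Hd t' Bt Ht').
  + intros s t _ Ht; apply retract_Omega, HU, Ht.
  + intros t _; apply retract_start; simpl; lra.
  + intros t _; apply retract_end; simpl; lra.
  + intros s _; simpl; rewrite Hloop; reflexivity.
Qed.

(** * Functions with given continuous partial derivatives *)

(** Naming the partial derivatives, instead of only asserting that they exist,
    lets products and compositions compute, and makes second-order
    statements iterations of the first-order one. *)
Definition C1_partials (D : C -> Prop) (f fx fy : R -> R -> R) : Prop :=
  forall x y : R, D (x, y) ->
    is_derive (fun t => f t y) x (fx x y) /\
    is_derive (fun t => f x t) y (fy x y) /\
    continuity_2d_pt fx x y /\ continuity_2d_pt fy x y.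

Lemma C1_partials_mono (D E : C -> Prop) f fx fy :
  (forall x y, E (x, y) -> D (x, y)) ->
  C1_partials D f fx fy -> C1_partials E f fx fy.
Proof. intros H Hf x y Hxy; apply Hf, H, Hxy. Qed.

Lemma C1_partials_ext (D : C -> Prop) f fx fy g gx gy :
  open D ->
  (forall x y, D (x, y) -> f x y = g x y /\ fx x y = gx x y /\ fy x y = gy x y) ->
  C1_partials D f fx fy -> C1_partials D g gx gy.
Proof.
intros HD He Hf x y Hxy.
destruct (Hf x y Hxy) as [H1 [H2 [H3 H4]]].
destruct (He x y Hxy) as [_ [<- <-]].
pose proof (open_locally_2d D x y HD Hxy) as HL.
split; [| split; [| split]].
- apply (is_derive_ext_loc (fun t => f t y)); [| exact H1].
  generalize (locally_2d_1d_const_y _ _ _ HL).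
  apply filter_imp; intros t Ht; apply He, Ht.
- apply (is_derive_ext_loc (fun t => f x t)); [| exact H2].
  generalize (locally_2d_1d_const_x _ _ _ HL).
  apply filter_imp; intros t Ht; apply He, Ht.
- apply continuity_2d_pt_ext_loc with (2 := H3).
  destruct HL as [d Hd]; exists d; intros u v Hu Hv; apply He, Hd; assumption.
- apply continuity_2d_pt_ext_loc with (2 := H4).
  destruct HL as [d Hd]; exists d; intros u v Hu Hv; apply He, Hd; assumption.
Qed.

Lemma C1_partials_Derive (D : C -> Prop) f fx fy x y :
  C1_partials D f fx fy -> D (x, y) -> dx f x y = fx x y /\ dy f x y = fy x y.
Proof.
intros Hf Hxy; destruct (Hf x y Hxy) as [H1 [H2 _]].
split; apply is_derive_unique; assumption.
Qed.

(** Continuous partial derivatives give differentiability, hence joint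
    continuity. *)
Lemma C1_partials_continuous (D : C -> Prop) f fx fy x y :
  open D -> C1_partials D f fx fy -> D (x, y) -> continuity_2d_pt f x y.
Proof.
intros HD Hf Hxy; destruct (Hf x y Hxy) as [_ [H2 [H3 _]]].
apply continuity_2d_pt_filterlim.
refine (filterdiff_continuous (fun u : R * R => f (fst u) (snd u)) (x, y) _).
eexists; apply (is_derive_filterdiff f x y fx (fy x y)); [| exact H2 |].
- apply (locally_2d_locally
           (fun u v => is_derive (fun z => f z v) u (fx u v))).
  destruct (open_locally_2d D x y HD Hxy) as [d Hd].
  exists d; intros u v Hu Hv; apply Hf, Hd; assumption.
- apply continuity_2d_pt_filterlim in H3; exact H3.
Qed.

Lemma C1_partials_mult (D : C -> Prop) f fx fy g gx gy :
  open D -> C1_partials D f fx fy -> C1_partials D g gx gy ->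
  C1_partials D (fun x y => f x y * g x y)
    (fun x y => fx x y * g x y + f x y * gx x y)
    (fun x y => fy x y * g x y + f x y * gy x y).
Proof.
intros HD Hf Hg x y Hxy.
pose proof (C1_partials_continuous D f fx fy x y HD Hf Hxy) as Cf.
pose proof (C1_partials_continuous D g gx gy x y HD Hg Hxy) as Cg.
destruct (Hf x y Hxy) as [F1 [F2 [F3 F4]]].
destruct (Hg x y Hxy) as [G1 [G2 [G3 G4]]].
split; [| split; [| split]].
- exact (Derive.is_derive_mult _ _ _ _ _ F1 G1).
- exact (Derive.is_derive_mult _ _ _ _ _ F2 G2).
- apply continuity_2d_pt_plus; apply continuity_2d_pt_mult; assumption.
- apply continuity_2d_pt_plus; apply continuity_2d_pt_mult; assumption.
Qed.

Definition C1_function (h h' : R -> R) : Prop :=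
  (forall t, is_derive h t (h' t)) /\ (forall t, continuous h' t).

Lemma C1_partials_comp (D : C -> Prop) (h h' : R -> R) f fx fy :
  open D -> C1_function h h' -> C1_partials D f fx fy ->
  C1_partials D (fun x y => h (f x y))
    (fun x y => fx x y * h' (f x y)) (fun x y => fy x y * h' (f x y)).
Proof.
intros HD [Hh Hc] Hf x y Hxy.
pose proof (C1_partials_continuous D f fx fy x y HD Hf Hxy) as Cf.
destruct (Hf x y Hxy) as [F1 [F2 [F3 F4]]].
assert (Ch : continuity_2d_pt (fun u v => h' (f u v)) x y).
{ apply continuity_1d_2d_pt_comp; [| exact Cf].
  apply continuity_pt_filterlim, Hc. }
split; [| split; [| split]].
- exact (is_derive_comp h (fun t => f t y) x _ _ (Hh _) F1).
- exact (is_derive_comp h (fun t => f x t) y _ _ (Hh _) F2).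
- apply continuity_2d_pt_mult; assumption.
- apply continuity_2d_pt_mult; assumption.
Qed.

Lemma C1_function_intro (h h' : R -> R) :
  (forall t, is_derive h t (h' t)) -> (forall t, ex_derive h' t) ->
  C1_function h h'.
Proof.
intros Hh Hh'; split; [exact Hh |].
intros t; exact (ex_derive_continuous h' t (Hh' t)).
Qed.

Lemma is_derive_cosh t : is_derive cosh t (sinh t).
Proof. apply is_derive_Reals, derivable_pt_lim_cosh. Qed.

Lemma is_derive_sinh t : is_derive sinh t (cosh t).
Proof. apply is_derive_Reals, derivable_pt_lim_sinh. Qed.

Lemma C1_cosh : C1_function cosh sinh.
Proof.
apply C1_function_intro; [exact is_derive_cosh |].
intros t; exists (cosh t); apply is_derive_sinh.
Qed.

Lemma C1_sinh : C1_function sinh cosh.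
Proof.
apply C1_function_intro; [exact is_derive_sinh |].
intros t; exists (sinh t); apply is_derive_cosh.
Qed.

Lemma C1_sin : C1_function sin cos.
Proof.
apply C1_function_intro; [exact is_derive_sin |].
intros t; auto_derive; exact I.
Qed.

Lemma C1_cos : C1_function cos (fun t => - sin t).
Proof.
apply C1_function_intro; [exact is_derive_cos |].
intros t; auto_derive; exact I.
Qed.

Lemma C1_partials_scal (D : C -> Prop) k f fx fy :
  open D -> C1_partials D f fx fy ->
  C1_partials D (fun x y => k * f x y) (fun x y => k * fx x y) (fun x y => k * fy x y).
Proof.
intros HD Hf.
apply (C1_partials_ext D (fun x y => k * f x y)
         (fun x y => fx x y * k) (fun x y => fy x y * k) _ _ _ HD).
- intros x y _; split; [reflexivity | split; ring].
- apply (C1_partials_comp D (fun t => k * t) (fun _ => k) f fx fy HD);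
    [| exact Hf].
  apply C1_function_intro; intros t; auto_derive; try exact I; ring.
Qed.

Lemma C1_partials_product (D : C -> Prop) (p p' q q' : R -> R)
    (w wx wy theta thetax thetay : R -> R -> R) :
  open D -> C1_partials D w wx wy -> C1_partials D theta thetax thetay ->
  C1_function p p' -> C1_function q q' ->
  C1_partials D (fun x y => p (w x y) * q (theta x y))
    (fun x y => wx x y * p' (w x y) * q (theta x y)
                + p (w x y) * (thetax x y * q' (theta x y)))
    (fun x y => wy x y * p' (w x y) * q (theta x y)
                + p (w x y) * (thetay x y * q' (theta x y))).
Proof. auto using C1_partials_mult, C1_partials_comp. Qed.

Lemma C2_on_partials (D : C -> Prop) f :
  C2_on D f ->
  C1_partials D f (dx f) (dy f) /\
  C1_partials D (dx f) (dx (dx f)) (dy (dx f)) /\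
  C1_partials D (dy f) (dx (dy f)) (dy (dy f)).
Proof.
intros Hf; split; [| split]; intros x y Hxy;
  destruct (Hf x y Hxy) as
    [_ [E1 [E2 [[Cx [Ex1 [Ex2 [[Cxx _] [Cxy _]]]]]
                [Cy [Ey1 [Ey2 [[Cyx _] [Cyy _]]]]]]]]];
  (split; [| split; [| split]]);
  first [assumption | apply Derive_correct; assumption].
Qed.

Lemma partials_C2_on (D : C -> Prop) f fx fy fxx fxy fyx fyy :
  open D -> C1_partials D f fx fy ->
  C1_partials D fx fxx fxy -> C1_partials D fy fyx fyy -> C2_on D f.
Proof.
intros HD Hf Hfx Hfy.
assert (Hd : forall x y, D (x, y) -> fx x y = dx f x y /\ fy x y = dy f x y).
{ intros u v Huv.
  destruct (C1_partials_Derive D f fx fy u v Hf Huv) as [-> ->]; auto. }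
assert (H1 : forall g gx gy, C1_partials D g gx gy ->
    forall x y, D (x, y) -> ex_diff_n g 1 x y).
{ intros g gx gy Hg x y Hxy.
  assert (He : C1_partials D g (dx g) (dy g)).
  { apply (C1_partials_ext D g gx gy); [exact HD | | exact Hg].
    intros u v Huv.
    destruct (C1_partials_Derive D g gx gy u v Hg Huv) as [-> ->]; auto. }
  pose proof (C1_partials_continuous D g gx gy x y HD Hg Hxy) as Cg.
  destruct (He x y Hxy) as [G1 [G2 [G3 G4]]].
  split; [exact Cg |]; split; [eexists; exact G1 |].
  split; [eexists; exact G2 |].
  split; split; auto. }
intros x y Hxy.
pose proof (C1_partials_continuous D f fx fy x y HD Hf Hxy) as Cf.
pose proof (open_locally_2d D x y HD Hxy) as [d HL].
destruct (Hf x y Hxy) as [F1 [F2 _]].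
split; [exact Cf |]; split; [eexists; exact F1 |]; split; [eexists; exact F2 |].
split.
- apply (ex_diff_n_ext_loc fx); [| exact (H1 _ _ _ Hfx x y Hxy)].
  exists d; intros u v Hu Hv; apply Hd, HL; assumption.
- apply (ex_diff_n_ext_loc fy); [| exact (H1 _ _ _ Hfy x y Hxy)].
  exists d; intros u v Hu Hv; apply Hd, HL; assumption.
Qed.

(** * Integrating a closed form along L-shaped paths *)

Definition potential (F G : R -> R -> R) (x y : R) : R :=
  RInt (fun t => F t 0) 0 x + RInt (fun s => G x s) 0 y.

Lemma continuity_2d_slices f x y :
  continuity_2d_pt f x y ->
  continuous (fun t => f t y) x /\ continuous (fun t => f x t) y.
Proof.
intros H; split; apply filterlim_locally; intros eps;
  destruct (H eps) as [d Hd]; exists d; intros t Ht; apply Hd;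
  try exact Ht; rewrite Rminus_diag, Rabs_R0; apply cond_pos.
Qed.

Lemma ex_RInt_legs (D : C -> Prop) F Fx Fy x y :
  open D -> C1_partials D F Fx Fy -> Omega D (x, y) ->
  ex_RInt (fun t => F t 0) 0 x /\ ex_RInt (fun s => F x s) 0 y.
Proof.
intros HD HF H; apply Omega_between in H; destruct H as [H1 H2].
split; apply (ex_RInt_continuous (V := R_CompleteNormedModule));
  intros t Ht.
- apply (continuity_2d_slices F t 0).
  exact (C1_partials_continuous D F Fx Fy t 0 HD HF (H1 t Ht)).
- apply (continuity_2d_slices F x t).
  exact (C1_partials_continuous D F Fx Fy x t HD HF (H2 t Ht)).
Qed.

(** The Poincare lemma for the closed form F dx + G dy.  In the vertical
    direction only the second integral moves.  In the horizontal direction the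
    first integral contributes F at the corner (x, 0), and closedness turns the
    derivative of the second into the integral of Fy, which is the increment of
    F up the vertical leg. *)
Lemma potential_partials (D : C -> Prop) F Fx Fy G Gx Gy :
  open D -> C1_partials D F Fx Fy -> C1_partials D G Gx Gy ->
  (forall x y, D (x, y) -> Fy x y = Gx x y) ->
  C1_partials (Omega D) (potential F G) F G.
Proof.
intros HD HF HG Hclosed x y Hxy.
pose proof (Omega_sub D x y Hxy) as Dxy.
pose proof (open_locally_2d _ x y (Omega_open D HD) Hxy) as HL.
pose proof (locally_2d_1d_const_y _ _ _ HL) as HLx.
pose proof (locally_2d_1d_const_x _ _ _ HL) as HLy.
pose proof (proj1 (Omega_between D x y) Hxy) as [Hh Hv].
pose proof (C1_partials_continuous D F Fx Fy x y HD HF Dxy) as CF.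
pose proof (C1_partials_continuous D G Gx Gy x y HD HG Dxy) as CG.
split; [| split; [| split]]; [| | exact CF | exact CG].
- assert (Hx0 : is_derive (fun z => RInt (fun t => F t 0) 0 z) x (F x 0)).
  { apply (is_derive_RInt (fun t => F t 0) _ 0 x).
    - generalize HLx; apply filter_imp; intros z Hz.
      apply (RInt_correct (V := R_CompleteNormedModule)).
      exact (proj1 (ex_RInt_legs D F Fx Fy z y HD HF Hz)).
    - apply (continuity_2d_slices F x 0).
      apply (C1_partials_continuous D F Fx Fy x 0 HD HF), Hh, between_refl. }
  assert (Hpar : is_derive (fun z => RInt (fun s => G z s) 0 y) x
            (RInt (fun s => Derive (fun z => G z s) x) 0 y)).
  { apply is_derive_RInt_param.
    - generalize HLx; apply filter_imp; intros z Hz s Hs.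
      apply Omega_between in Hz.
      exists (Gx z s); exact (proj1 (HG z s (proj2 Hz s Hs))).
    - intros s Hs; pose proof (Hv s Hs) as Ds.
      destruct (HG x s Ds) as [_ [_ [CGx _]]].
      apply continuity_2d_pt_ext_loc with (2 := CGx).
      destruct (open_locally_2d D x s HD Ds) as [d Hd].
      exists d; intros u v Hu Hv'; symmetry.
      apply is_derive_unique, HG, Hd; assumption.
    - generalize HLx; apply filter_imp; intros z Hz.
      exact (proj2 (ex_RInt_legs D G Gx Gy z y HD HG Hz)). }
  assert (Hval : RInt (fun s => Derive (fun z => G z s) x) 0 y = F x y - F x 0).
  { transitivity (RInt (fun s => Fy x s) 0 y).
    - apply RInt_ext; intros s Hs.
      assert (Ds : D (x, s)) by (apply Hv; unfold between; lra).
      rewrite (Hclosed x s Ds); apply is_derive_unique, HG, Ds.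
    - apply is_RInt_unique.
      apply (is_RInt_derive (V := R_CompleteNormedModule) (fun s => F x s)).
      + intros s Hs; apply HF, Hv, Hs.
      + intros s Hs; apply (continuity_2d_slices Fy x s), HF, Hv, Hs. }
  replace (F x y) with (plus (F x 0) (F x y - F x 0))
    by (unfold plus; simpl; ring).
  rewrite <- Hval.
  exact (is_derive_plus _ _ _ _ _ Hx0 Hpar).
- rewrite <- (Rplus_0_l (G x y)).
  refine (is_derive_plus _ _ _ _ _ (is_derive_const _ _) _).
  apply (is_derive_RInt (fun s => G x s) _ 0 y).
  + generalize HLy; apply filter_imp; intros z Hz.
    apply (RInt_correct (V := R_CompleteNormedModule)).
    exact (proj2 (ex_RInt_legs D G Gx Gy x z HD HG Hz)).
  + apply (continuity_2d_slices G x y CG).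
Qed.

(** * Consequences of the Backlund transformation *)

Lemma BT_partials {D : C -> Prop} {w theta : R -> R -> R} (HD : open D)
    (HBT : class_BT D w theta) {p p' q q' : R -> R} :
  C1_function p p' -> C1_function q q' ->
  C1_partials D (fun x y => p (w x y) * q (theta x y))
    (fun x y => dx w x y * p' (w x y) * q (theta x y)
                + p (w x y) * (dx theta x y * q' (theta x y)))
    (fun x y => dy w x y * p' (w x y) * q (theta x y)
                + p (w x y) * (dy theta x y * q' (theta x y))).
Proof.
destruct HBT as [W2 [T2 _]].
apply C1_partials_product; [exact HD | |]; apply C2_on_partials; assumption.
Qed.

(** The x-derivative of the first equation and the y-derivative of the second
    add up to the Laplacian of w: the mixed derivatives of theta cancel, and
    after a second use of the equations the right-hand sides give
    4 sinh w cosh w (sin^2 theta + cos^2 theta). *)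
Lemma BT_sinh_gordon (D : C -> Prop) (w theta : R -> R -> R) :
  open D -> class_BT D w theta -> sinh_gordon D w.
Proof.
intros HD HBT; pose proof HBT as [W2 [T2 HB]].
split; [exact W2 |]; intros x y Hxy.
destruct (C2_on_partials D w W2) as [_ [Wx Wy]].
destruct (C2_on_partials D theta T2) as [Htheta [Tx Ty]].
assert (Schw : dx (dy theta) x y = dy (dx theta) x y).
{ apply (Schwarz theta x y).
  - destruct (open_locally_2d D x y HD Hxy) as [d Hd].
    exists d; intros u v Hu Hv; pose proof (Hd u v Hu Hv) as Huv.
    destruct (Htheta u v Huv) as [D1 [D2 _]].
    destruct (Ty u v Huv) as [D12 _]; destruct (Tx u v Huv) as [_ [D21 _]].
    exact (conj (ex_intro _ _ D1) (conj (ex_intro _ _ D2)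
             (conj (ex_intro _ _ D12) (ex_intro _ _ D21)))).
  - apply Ty, Hxy.
  - apply Tx, Hxy. }
assert (Exx : dx (dx w) x y = dx (dy theta) x y
  + -2 * (dx w x y * cosh (w x y) * sin (theta x y)
          + sinh (w x y) * (dx theta x y * cos (theta x y)))).
{ transitivity (dx (fun u v => dy theta u v
                      + -2 * (sinh (w u v) * sin (theta u v))) x y).
  - apply Derive_ext_loc.
    generalize (locally_2d_1d_const_y _ _ _ (open_locally_2d D x y HD Hxy)).
    apply filter_imp; intros t Ht; destruct (HB t y Ht); lra.
  - exact (is_derive_unique _ _ _ (is_derive_plus _ _ _ _ _
      (proj1 (Ty x y Hxy))
      (is_derive_scal _ _ (-2) _
         (proj1 (BT_partials HD HBT C1_sinh C1_sin x y Hxy))))). }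
assert (Eyy : dy (dy w) x y = -1 * dy (dx theta) x y
  + -2 * (dy w x y * sinh (w x y) * cos (theta x y)
          + cosh (w x y) * (dy theta x y * - sin (theta x y)))).
{ transitivity (dy (fun u v => -1 * dx theta u v
                      + -2 * (cosh (w u v) * cos (theta u v))) x y).
  - apply Derive_ext_loc.
    generalize (locally_2d_1d_const_x _ _ _ (open_locally_2d D x y HD Hxy)).
    apply filter_imp; intros t Ht; destruct (HB x t Ht); lra.
  - exact (is_derive_unique _ _ _ (is_derive_plus _ _ _ _ _
      (is_derive_scal _ _ (-1) _ (proj1 (proj2 (Tx x y Hxy))))
      (is_derive_scal _ _ (-2) _
         (proj1 (proj2 (BT_partials HD HBT C1_cosh C1_cos x y Hxy)))))). }
unfold laplacian; rewrite Exx, Eyy, Schw.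
destruct (HB x y Hxy) as [B1 B2].
replace (dx w x y) with (dy theta x y + -2 * sinh (w x y) * sin (theta x y)) by lra.
replace (dy w x y) with (- dx theta x y + -2 * cosh (w x y) * cos (theta x y)) by lra.
replace (sinh (2 * w x y)) with (2 * sinh (w x y) * cosh (w x y)).
2:{ unfold sinh, cosh.
  replace (2 * w x y) with (w x y + w x y) by ring.
  rewrite Ropp_plus_distr, !exp_plus; field. }
pose proof (sin2_cos2 (theta x y)) as Hsc; unfold Rsqr in Hsc.
replace (2 * (2 * sinh (w x y) * cosh (w x y)))
  with (4 * sinh (w x y) * cosh (w x y)
        * (sin (theta x y) * sin (theta x y) + cos (theta x y) * cos (theta x y)))
  by (rewrite Hsc; ring).
ring.
Qed.

(** I1 + I2 is the potential of (ch s, sh c), whose closedness is a combination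
    of the two Backlund equations; S is S0 times the exponential of twice it. *)
Lemma S_partials (D : C -> Prop) (w theta : R -> R -> R) (S0 : R) :
  open D -> class_BT D w theta ->
  C1_partials (Omega D) (S_map w theta S0)
    (fun x y => 2 * (S_map w theta S0 x y * (cosh (w x y) * sin (theta x y))))
    (fun x y => 2 * (S_map w theta S0 x y * (sinh (w x y) * cos (theta x y)))).
Proof.
intros HD HBT.
set (P := potential (fun x y => cosh (w x y) * sin (theta x y))
                    (fun x y => sinh (w x y) * cos (theta x y))).
assert (HP := potential_partials D _ _ _ _ _ _ HD
  (BT_partials HD HBT C1_cosh C1_sin) (BT_partials HD HBT C1_sinh C1_cos)).
fold P in HP.
assert (HOD := Omega_open D HD).
apply (C1_partials_ext (Omega D) (fun x y => S0 * exp (2 * P x y))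
  (fun x y => cosh (w x y) * sin (theta x y) * (2 * S0 * exp (2 * P x y)))
  (fun x y => sinh (w x y) * cos (theta x y) * (2 * S0 * exp (2 * P x y)))
  _ _ _ HOD).
- intros x y _; unfold S_map, P, potential, I1, I2.
  split; [reflexivity | split; ring].
- apply (C1_partials_comp (Omega D) (fun t => S0 * exp (2 * t))
           (fun t => 2 * S0 * exp (2 * t)) P _ _ HOD).
  + apply C1_function_intro; intros t; auto_derive; try exact I; ring.
  + apply HP; intros x y Hxy; destruct HBT as [_ [_ HB]].
    destruct (HB x y Hxy) as [B1 B2].
    replace (dx w x y) with (dy theta x y + -2 * sinh (w x y) * sin (theta x y)) by lra.
    replace (dy w x y) with (- dx theta x y + -2 * cosh (w x y) * cos (theta x y)) by lra.
    ring.
Qed.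

Lemma S_neq_0 w theta S0 x y : S0 <> 0 -> S_map w theta S0 x y <> 0.
Proof.
intros HS0; apply Rmult_integral_contrapositive_currified; [exact HS0 |].
apply Rgt_not_eq, exp_pos.
Qed.

(** The partial derivatives of R and S and the components of d_zbar u all have
    the form k S f with f a function of w and theta. *)
Lemma S_mult_partials {D : C -> Prop} {w theta : R -> R -> R} (S0 : R)
    (HD : open D) (HBT : class_BT D w theta) (k : R) {f fx fy} :
  C1_partials D f fx fy ->
  C1_partials (Omega D) (fun x y => k * (S_map w theta S0 x y * f x y))
    (fun x y => k * (2 * (S_map w theta S0 x y * (cosh (w x y) * sin (theta x y)))
                     * f x y + S_map w theta S0 x y * fx x y))
    (fun x y => k * (2 * (S_map w theta S0 x y * (sinh (w x y) * cos (theta x y)))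
                     * f x y + S_map w theta S0 x y * fy x y)).
Proof.
intros Hf; assert (HOD := Omega_open D HD).
apply C1_partials_scal, C1_partials_mult; auto using S_partials.
exact (C1_partials_mono D (Omega D) f fx fy (Omega_sub D) Hf).
Qed.

(** The factor exp (2 I1 x) in front of the integral in I4 is constant along
    the vertical leg, and I2 vanishes on the horizontal axis; so both I3 and I4
    integrate multiples of the full factor S. *)
Lemma R_map_potential (D : C -> Prop) (w theta : R -> R -> R) (R0 S0 x y : R) :
  open D -> class_BT D w theta -> S0 <> 0 ->
  Omega D (x, y) ->
  R_map w theta R0 S0 x y =
  R0 + potential
    (fun x y => 2 * (S_map w theta S0 x y * (cosh (w x y) * cos (theta x y))))
    (fun x y => -2 * (S_map w theta S0 x y * (sinh (w x y) * sin (theta x y)))) x y.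
Proof.
intros HD HBT HS0 Hxy; assert (HOD := Omega_open D HD).
assert (HF := S_mult_partials S0 HD HBT 2
  (BT_partials HD HBT C1_cosh C1_cos)).
assert (HG := S_mult_partials S0 HD HBT (-2)
  (BT_partials HD HBT C1_sinh C1_sin)).
destruct (ex_RInt_legs _ _ _ _ x y HOD HF (Omega_idem D x y Hxy)) as [EF _].
destruct (ex_RInt_legs _ _ _ _ x y HOD HG (Omega_idem D x y Hxy)) as [_ EG].
assert (H3 : I3 w theta x = / (2 * S0) * RInt (fun t =>
    2 * (S_map w theta S0 t 0 * (cosh (w t 0) * cos (theta t 0)))) 0 x).
{ refine (eq_trans _ (RInt_scal (V := R_CompleteNormedModule) _ 0 x
                           (/ (2 * S0)) EF)).
  apply (RInt_ext (V := R_CompleteNormedModule)); intros t _.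
  unfold scal; simpl; unfold mult; simpl.
  unfold S_map, I2; rewrite RInt_point; unfold zero; simpl.
  rewrite Rplus_0_r; field; exact HS0. }
assert (H4 : I4 w theta x y = - / (2 * S0) * RInt (fun s =>
    -2 * (S_map w theta S0 x s * (sinh (w x s) * sin (theta x s)))) 0 y).
{ unfold I4.
  assert (He : exp (2 * I1 w theta x) <> 0) by apply Rgt_not_eq, exp_pos.
  replace (RInt (fun s => exp (2 * I2 w theta x s) * sinh (w x s) * sin (theta x s)) 0 y)
    with (- / (2 * S0 * exp (2 * I1 w theta x)) * RInt (fun s =>
    -2 * (S_map w theta S0 x s * (sinh (w x s) * sin (theta x s)))) 0 y).
  { field; split; assumption. }
  refine (eq_trans (eq_sym (RInt_scal (V := R_CompleteNormedModule) _ 0 y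
                (- / (2 * S0 * exp (2 * I1 w theta x))) EG)) _).
  apply (RInt_ext (V := R_CompleteNormedModule)); intros s _.
  unfold scal; simpl; unfold mult; simpl.
  unfold S_map; rewrite Rmult_plus_distr_l, exp_plus; field; split; assumption. }
unfold R_map, potential; rewrite H3, H4; field; exact HS0.
Qed.

(** The equality of mixed derivatives here uses the derivatives of S, the
    Backlund equations and sin^2 + cos^2 = 1. *)
Lemma R_partials (D : C -> Prop) (w theta : R -> R -> R) (R0 S0 : R) :
  open D -> class_BT D w theta -> S0 <> 0 ->
  C1_partials (Omega D) (R_map w theta R0 S0)
    (fun x y => 2 * (S_map w theta S0 x y * (cosh (w x y) * cos (theta x y))))
    (fun x y => -2 * (S_map w theta S0 x y * (sinh (w x y) * sin (theta x y)))).
Proof.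
intros HD HBT HS0; assert (HOD := Omega_open D HD).
assert (HF := S_mult_partials S0 HD HBT 2
  (BT_partials HD HBT C1_cosh C1_cos)).
assert (HG := S_mult_partials S0 HD HBT (-2)
  (BT_partials HD HBT C1_sinh C1_sin)).
assert (HQ := potential_partials (Omega D) _ _ _ _ _ _ HOD HF HG).
match type of HQ with _ -> C1_partials _ ?Q ?F ?G =>
  apply (C1_partials_ext (Omega D) (fun x y => R0 + Q x y)
           (fun x y => F x y * 1) (fun x y => G x y * 1) _ _ _ HOD);
  [| apply (C1_partials_comp (Omega D) (fun t => R0 + t) (fun _ => 1) Q F G HOD)]
end.
- intros x y Hxy; rewrite (R_map_potential D w theta R0 S0 x y HD HBT HS0 Hxy).
  split; [reflexivity | split; ring].
- apply C1_function_intro; intros t; auto_derive; try exact I; ring.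
- apply (C1_partials_mono (Omega (Omega D)) (Omega D)); [apply Omega_idem |].
  apply HQ; intros x y Hxy; destruct HBT as [_ [_ HB]].
  destruct (HB x y (Omega_sub D x y Hxy)) as [B1 B2].
  pose proof (sin2_cos2 (theta x y)) as Hsc; unfold Rsqr in Hsc.
  set (s := S_map w theta S0 x y).
  transitivity (s * (4 * sinh (w x y) * cosh (w x y) * (cos (theta x y) * cos (theta x y))
     + 2 * (dy w x y * sinh (w x y) * cos (theta x y)
            - cosh (w x y) * dy theta x y * sin (theta x y)))); [ring |].
  replace (cos (theta x y) * cos (theta x y))
    with (1 - sin (theta x y) * sin (theta x y)) by lra.
  replace (dx w x y) with (dy theta x y + -2 * sinh (w x y) * sin (theta x y)) by lra.
  replace (dy w x y) with (- dx theta x y + -2 * cosh (w x y) * cos (theta x y)) by lra.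
  transitivity (s * (4 * sinh (w x y) * cosh (w x y) * (1 - sin (theta x y) * sin (theta x y)
     - cos (theta x y) * cos (theta x y))
     - 2 * (dx theta x y * sinh (w x y) * cos (theta x y)
            + cosh (w x y) * dy theta x y * sin (theta x y)))); [ring |].
  replace (1 - _ - _) with 0 by lra; ring.
Qed.

(** * The map u = R + i S *)

Lemma Wirtinger_partials (D : C -> Prop) u Rx Ry Sx Sy x y :
  C1_partials D (Re_part u) Rx Ry -> C1_partials D (Im_part u) Sx Sy ->
  D (x, y) ->
  d_z u x y = ((Rx x y + Sy x y) / 2, (Sx x y - Ry x y) / 2) /\
  d_zbar u x y = ((Rx x y - Sy x y) / 2, (Sx x y + Ry x y) / 2).
Proof.
intros HR HS Hxy.
destruct (C1_partials_Derive _ _ _ _ _ _ HR Hxy) as [ERx ERy].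
destruct (C1_partials_Derive _ _ _ _ _ _ HS Hxy) as [ESx ESy].
unfold d_z, d_zbar, Cdx, Cdy; rewrite ERx, ERy, ESx, ESy.
split; apply injective_projections; simpl; field.
Qed.

Lemma exp_cosh_sinh t : exp t = cosh t + sinh t /\ exp (- t) = cosh t - sinh t.
Proof. unfold cosh, sinh; split; field. Qed.

Lemma Re_u_map w theta R0 S0 x y :
  Re_part (u_map w theta R0 S0) x y = R_map w theta R0 S0 x y.
Proof. unfold Re_part, u_map; simpl; ring. Qed.

Lemma Im_u_map w theta R0 S0 x y :
  Im_part (u_map w theta R0 S0) x y = S_map w theta S0 x y.
Proof. unfold Im_part, u_map; simpl; ring. Qed.

Lemma u_map_parts (D : C -> Prop) (w theta : R -> R -> R) (R0 S0 : R) :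
  open D -> class_BT D w theta -> S0 <> 0 ->
  C1_partials (Omega D) (Re_part (u_map w theta R0 S0))
    (fun x y => 2 * (S_map w theta S0 x y * (cosh (w x y) * cos (theta x y))))
    (fun x y => -2 * (S_map w theta S0 x y * (sinh (w x y) * sin (theta x y)))) /\
  C1_partials (Omega D) (Im_part (u_map w theta R0 S0))
    (fun x y => 2 * (S_map w theta S0 x y * (cosh (w x y) * sin (theta x y))))
    (fun x y => 2 * (S_map w theta S0 x y * (sinh (w x y) * cos (theta x y)))).
Proof.
intros HD HBT HS0; assert (HOD := Omega_open D HD); split.
- apply (C1_partials_ext (Omega D) (R_map w theta R0 S0) _ _ _ _ _ HOD
           (fun x y _ => conj (eq_sym (Re_u_map w theta R0 S0 x y))
                              (conj eq_refl eq_refl))).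
  apply R_partials; assumption.
- apply (C1_partials_ext (Omega D) (S_map w theta S0) _ _ _ _ _ HOD
           (fun x y _ => conj (eq_sym (Im_u_map w theta R0 S0 x y))
                              (conj eq_refl eq_refl))).
  apply S_partials; assumption.
Qed.

(** d_z u = S exp (w + i theta) and d_zbar u = S exp (- w + i theta): the
    factors ch + sh and ch - sh appear when the four partial derivatives are
    combined. *)
Lemma u_map_Wirtinger (D : C -> Prop) (w theta : R -> R -> R) (R0 S0 x y : R) :
  open D -> class_BT D w theta -> S0 <> 0 -> Omega D (x, y) ->
  d_z (u_map w theta R0 S0) x y =
    (S_map w theta S0 x y * (exp (w x y) * cos (theta x y)),
     S_map w theta S0 x y * (exp (w x y) * sin (theta x y))) /\
  d_zbar (u_map w theta R0 S0) x y =
    (S_map w theta S0 x y * (exp (- w x y) * cos (theta x y)),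
     S_map w theta S0 x y * (exp (- w x y) * sin (theta x y))).
Proof.
intros HD HBT HS0 Hxy.
destruct (u_map_parts D w theta R0 S0 HD HBT HS0) as [HR HS].
destruct (Wirtinger_partials _ _ _ _ _ _ x y HR HS Hxy) as [-> ->].
destruct (exp_cosh_sinh (w x y)) as [-> ->].
split; apply injective_projections; simpl; field.
Qed.

Lemma u_map_beltrami (D : C -> Prop) (w theta : R -> R -> R) (R0 S0 : R) :
  open D -> class_BT D w theta -> S0 <> 0 ->
  beltrami (Omega D) w (u_map w theta R0 S0).
Proof.
intros HD HBT HS0 x y Hxy.
destruct (u_map_Wirtinger D w theta R0 S0 x y HD HBT HS0 Hxy) as [Ez Ezbar].
assert (Hz : d_z (u_map w theta R0 S0) x y <> RtoC 0).
{ rewrite Ez; intros H; injection H as Hc Hs.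
  pose proof (S_neq_0 w theta S0 x y HS0) as HS.
  pose proof (exp_pos (w x y)) as He.
  pose proof (sin2_cos2 (theta x y)) as Hsc; unfold Rsqr in Hsc.
  apply Rmult_integral in Hc; apply Rmult_integral in Hs.
  destruct Hc as [Hc | Hc]; [contradiction |].
  destruct Hs as [Hs | Hs]; [contradiction |].
  apply Rmult_integral in Hc; apply Rmult_integral in Hs.
  destruct Hc as [Hc | Hc]; [lra |]; destruct Hs as [Hs | Hs]; [lra |].
  rewrite Hc, Hs in Hsc; lra. }
split; [exact Hz |].
assert (E : d_zbar (u_map w theta R0 S0) x y
            = (RtoC (exp (-2 * w x y)) * d_z (u_map w theta R0 S0) x y)%C).
{ rewrite Ez, Ezbar.
  replace (- w x y) with (-2 * w x y + w x y) by ring; rewrite exp_plus.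
  apply injective_projections; simpl; ring. }
rewrite E; field; exact Hz.
Qed.

(** The z-derivative of the conjugate of u is the conjugate of d_zbar u, and the
    exponentials of w and - w and those of i theta and - i theta cancel. *)
Lemma u_map_hopf_normalized (D : C -> Prop) (w theta : R -> R -> R) (R0 S0 : R) :
  open D -> class_BT D w theta -> S0 <> 0 ->
  hopf_normalized (Omega D) (u_map w theta R0 S0).
Proof.
intros HD HBT HS0 x y Hxy; assert (HOD := Omega_open D HD).
destruct (u_map_Wirtinger D w theta R0 S0 x y HD HBT HS0 Hxy) as [Ez _].
destruct (u_map_parts D w theta R0 S0 HD HBT HS0) as [HR HS].
assert (HS' : C1_partials (Omega D)
   (Im_part (fun a b => Cconj (u_map w theta R0 S0 a b)))
   (fun x y => -1 * (2 * (S_map w theta S0 x y * (cosh (w x y) * sin (theta x y)))))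
   (fun x y => -1 * (2 * (S_map w theta S0 x y * (sinh (w x y) * cos (theta x y)))))).
{ refine (C1_partials_ext _ _ _ _ _ _ _ HOD _
            (C1_partials_scal _ (-1) _ _ _ HOD HS)).
  intros a b _; split; [| split; reflexivity].
  unfold Im_part, Cconj; simpl; unfold Im; ring. }
destruct (Wirtinger_partials _ (fun a b => Cconj (u_map w theta R0 S0 a b))
            _ _ _ _ x y HR HS' Hxy) as [-> _].
rewrite Ez; change (Im (u_map w theta R0 S0 x y)) with
  (Im_part (u_map w theta R0 S0) x y); rewrite Im_u_map.
pose proof (S_neq_0 w theta S0 x y HS0) as Hne.
pose proof (sin2_cos2 (theta x y)) as Hsc; unfold Rsqr in Hsc.
set (s := S_map w theta S0 x y) in *.
assert (He : exp (w x y) * (cosh (w x y) - sinh (w x y)) = 1).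
{ rewrite <- (proj2 (exp_cosh_sinh (w x y))), <- exp_plus, Rplus_opp_r; exact exp_0. }
match goal with |- (?A / _)%C = _ => replace A with (RtoC (s ^ 2)) end.
- field; intros H; apply RtoC_inj in H; revert H; apply pow_nonzero, Hne.
- apply injective_projections; simpl.
  + transitivity (s * s * (exp (w x y) * (cosh (w x y) - sinh (w x y)))
      * (sin (theta x y) * sin (theta x y) + cos (theta x y) * cos (theta x y))).
    * rewrite He, Hsc; ring.
    * field.
  + field.
Qed.

(** The formulas of [u_map_Wirtinger] hold on an open set, so the formula for
    d_zbar u may be differentiated; both terms of the harmonic map equation are
    multiples of S exp (2 i theta), with opposite coefficients. *)
Lemma u_map_harmonic (D : C -> Prop) (w theta : R -> R -> R) (R0 S0 : R) :
  open D -> class_BT D w theta -> S0 <> 0 ->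
  harmonic (Omega D) (u_map w theta R0 S0).
Proof.
intros HD HBT HS0 x y Hxy; assert (HOD := Omega_open D HD).
assert (Hexp : C1_function (fun t => exp (- t)) (fun t => - exp (- t))).
{ apply C1_function_intro; intros t; auto_derive; try exact I; ring. }
assert (HR := S_mult_partials S0 HD HBT 1
  (BT_partials HD HBT Hexp C1_cos)).
assert (HS := S_mult_partials S0 HD HBT 1
  (BT_partials HD HBT Hexp C1_sin)).
eapply (C1_partials_ext (Omega D) _ _ _ (Re_part (d_zbar (u_map w theta R0 S0)))
          _ _ HOD) in HR.
2:{ intros a b Hab; split; [| split; reflexivity]; unfold Re_part.
  rewrite (proj2 (u_map_Wirtinger D w theta R0 S0 a b HD HBT HS0 Hab)).
  simpl; ring. }
eapply (C1_partials_ext (Omega D) _ _ _ (Im_part (d_zbar (u_map w theta R0 S0)))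
          _ _ HOD) in HS.
2:{ intros a b Hab; split; [| split; reflexivity]; unfold Im_part.
  rewrite (proj2 (u_map_Wirtinger D w theta R0 S0 a b HD HBT HS0 Hab)).
  simpl; ring. }
destruct (Wirtinger_partials _ _ _ _ _ _ x y HR HS Hxy) as [-> _].
destruct (u_map_Wirtinger D w theta R0 S0 x y HD HBT HS0 Hxy) as [-> ->].
change (Im (u_map w theta R0 S0 x y)) with
  (Im_part (u_map w theta R0 S0) x y); rewrite Im_u_map.
pose proof (S_neq_0 w theta S0 x y HS0) as Hne.
destruct HBT as [_ [_ HB]]; destruct (HB x y (Omega_sub D x y Hxy)) as [B1 B2].
replace (dx w x y) with (dy theta x y + -2 * sinh (w x y) * sin (theta x y)) by lra.
replace (dy w x y) with (- dx theta x y + -2 * cosh (w x y) * cos (theta x y)) by lra.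
set (s := S_map w theta S0 x y) in *.
assert (He : exp (- w x y) * exp (w x y) = 1).
{ rewrite <- exp_plus, Rplus_opp_l; exact exp_0. }
replace (cosh (w x y)) with ((exp (w x y) + exp (- w x y)) / 2) by reflexivity.
replace (sinh (w x y)) with ((exp (w x y) - exp (- w x y)) / 2) by reflexivity.
set (e := exp (w x y)) in *; set (q := exp (- w x y)) in *.
set (c := cos (theta x y)); set (d := sin (theta x y)).
(* The nonlinear term is i S exp (2 i theta), since e q = 1. *)
replace (Ci / RtoC s * _)%C with ((-2 * s * c * d, s * (c * c - d * d)) : C).
- apply injective_projections; simpl.
  + transitivity (2 * s * c * d * (q * e - 1)); [field | rewrite He; ring].
  + transitivity (s * (d * d - c * c) * (q * e - 1)); [field | rewrite He; ring].
- transitivity (RtoC (/ s) * (Ci * (((s * (e * c), s * (e * d))%R : C)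
                                 * ((s * (q * c), s * (q * d))%R : C))))%C.
  + apply injective_projections; simpl.
    * transitivity (-2 * s * c * d * (q * e)); [rewrite He; ring | field; exact Hne].
    * transitivity (s * (c * c - d * d) * (q * e)); [rewrite He; ring | field; exact Hne].
  + rewrite (RtoC_inv s Hne), Cmult_assoc, (Cmult_comm (/ RtoC s)); reflexivity.
Qed.

Theorem proposition3 :
  forall (U : C -> Prop) (w theta : R -> R -> R) (R0 S0 : R),
    open U -> simply_connected U -> U (0, 0) ->
    class_BT U w theta ->
    S0 <> 0 ->
    (R_map w theta R0 S0 0 0 = R0 /\ S_map w theta S0 0 0 = S0) /\
    corresponding_harmonic_map (Omega U) w (u_map w theta R0 S0).
Proof.
intros U w theta R0 S0 HU _ H0 HBT HS0.
assert (HOD := Omega_open U HU).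
destruct (u_map_parts U w theta R0 S0 HU HBT HS0) as [HR HS].
assert (H2 := fun k p p' q q' (Hp : C1_function p p') (Hq : C1_function q q') =>
                S_mult_partials S0 HU HBT k
                (BT_partials HU HBT Hp Hq)).
split; [| split; [| split; [| split; [| split; [| split; [| split]]]]]].
- unfold R_map, S_map, I4, I3, I2, I1.
  rewrite !RInt_point; unfold zero; simpl.
  split; [ring | rewrite Rplus_0_r, Rmult_0_r, exp_0; ring].
- split; [exact HOD |]; split; [apply Omega_simply_connected |].
  apply Omega_between; split; intros s Hs; replace s with 0; try exact H0;
    unfold between, Rmin, Rmax in Hs; destruct (Rle_dec 0 0); lra.
- destruct (BT_sinh_gordon U w theta HU HBT) as [W2 E]; split;
    intros x y Hxy; [apply W2 | apply E]; exact (Omega_sub U x y Hxy).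
- split.
  + exact (partials_C2_on _ _ _ _ _ _ _ _ HOD HR
             (H2 _ _ _ _ _ C1_cosh C1_cos) (H2 _ _ _ _ _ C1_sinh C1_sin)).
  + exact (partials_C2_on _ _ _ _ _ _ _ _ HOD HS
             (H2 _ _ _ _ _ C1_cosh C1_sin) (H2 _ _ _ _ _ C1_sinh C1_cos)).
- intros x y _; change (Im_part (u_map w theta R0 S0) x y <> 0).
  rewrite Im_u_map; exact (S_neq_0 w theta S0 x y HS0).
- exact (u_map_beltrami U w theta R0 S0 HU HBT HS0).
- exact (u_map_harmonic U w theta R0 S0 HU HBT HS0).
- exact (u_map_hopf_normalized U w theta R0 S0 HU HBT HS0).
Qed.
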